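(* For any string $S$, $|\mathcal{PS}_S| \leq |S| + |\mathcal{M}_S| - 1$.
   Context: For a string $S$ of length $n$ and $1 \le i \le j \le n$, $S[i..j]$ is the substring from position $i$ to position $j$, and $\#\mathit{occ}_S(w)$ is the number of positions $i$ with $S[i..i+|w|-1]=w$. A non-empty substring $w$ is unique if $\#\mathit{occ}_S(w)=1$ and repeating if $\#\mathit{occ}_S(w)\ge 2$; an interval $[i,j]$ is called unique/repeating according to $S[i..j]$. An interval $[i,j]$ is a minimal unique substring (MUS) of $S$ if $S[i..j]$ is unique and every proper substring $S[i'..j']$ with $i\le i'$, $j'\le j$, $j'-i'<j-i$ is repeating; $\mathcal{M}_S$ is the set of all MUS intervals of $S$. For intervals, $[s,t]\subset[i,j]$ means $i\le s$ and $t\le j$. For an interval $[s,t]$, an interval $[i,j]$ is a shortest unique substring (SUS) for $[s,t]$ if (1) $S[i..j]$ is unique, (2) $[s,t]\subset[i,j]$, and (3) $S[i'..j']$ is repeating for every $[i',j']$ with $[s,t]\subset[i',j']$ and $j'-i'<j-i$. $\mathsf{SUS}_S(p)$ denotes the set of SUSs for $[p,p]$, and $\mathcal{PS}_S=\bigcup_{p=1}^{n}\mathsf{SUS}_S(p)$ is the set of all point SUSs of $S$. *)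

(* Defs.v *)
From mathcomp Require Import all_boot.
Set Implicit Arguments.
Unset Strict Implicit.
Unset Printing Implicit Defensive.

(* Positions are 0-based: the ordinal k stands for the textual position k + 1. *)

Section Strings.
Variable T : eqType.
Implicit Types (S w : seq T).

Definition occ S w : nat :=
  #|[set i : 'I_(size S) | take (size w) (drop i S) == w]|.

Definition unique_sub S w : bool := (w != [::]) && (occ S w == 1).
Definition repeating_sub S w : bool := (w != [::]) && (2 <= occ S w).

(* A pair I : interval S is an actual interval only when wf_interval I holds. *)
Definition interval S : finType := ('I_(size S) * 'I_(size S))%type.

Definition wf_interval S (I : interval S) : bool := I.1 <= I.2.

Definition substr S (I : interval S) : seq T := take (I.2.+1 - I.1) (drop I.1 S).

Definition unique S (I : interval S) : bool :=
  wf_interval I && unique_sub S (substr I).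
Definition repeating S (I : interval S) : bool :=
  wf_interval I && repeating_sub S (substr I).

Definition sub_interval S (I J : interval S) : bool :=
  (J.1 <= I.1) && (I.2 <= J.2).

(* On well-formed intervals the truncated difference I.2 - I.1 is exact. *)
Definition shorter S (I J : interval S) : bool := I.2 - I.1 < J.2 - J.1.

Definition is_MUS S (I : interval S) : bool :=
  unique I &&
  [forall J : interval S,
     [&& wf_interval J, sub_interval J I & shorter J I] ==> repeating J].

Definition MUS S : {set interval S} := [set I | is_MUS I].

Definition is_SUS S (K I : interval S) : bool :=
  [&& unique I, sub_interval K I &
   [forall J : interval S,
      [&& wf_interval J, sub_interval K J & shorter J I] ==> repeating J]].

Definition point_SUS S (p : 'I_(size S)) : {set interval S} :=
  [set I | @is_SUS S (p, p) I].

Definition PS S : {set interval S} := \bigcup_(p : 'I_(size S)) point_SUS p.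

End Strings.

(* Main.v *)
Require Import Defs.
From mathcomp Require Import all_boot zify.

Set Implicit Arguments.
Unset Strict Implicit.
Unset Printing Implicit Defensive.

(** A point SUS [i, j] that is not a MUS contains a shorter unique interval,
    which must miss the point; hence [i, j] is a SUS for i with [i+1, j] unique
    (a left extension), or a SUS for j with [i, j-1] unique (a right extension).
    Send a left extension to the gap between i and i+1, and a right extension to
    the gap between j-1 and j. Two extensions of the same kind over the same gap
    are SUSs for the same point sharing an endpoint, so they coincide. If
    a left extension [i, j] and a right extension [i', i+1] shared a gap, then
    [i+1, j] would be a unique interval containing i+1 and shorter than [i, j],
    hence shorter than [i', i+1], as both of the latter contain i: impossible.
    So at most |S| - 1 point SUSs are not MUSs. *)

Section PointSUS.
Variables (T : eqType) (S : seq T).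
Implicit Types (I J K : interval S) (p : 'I_(size S)).

Lemma size_substr I : size (substr I) = I.2.+1 - I.1.
Proof.
rewrite /substr size_take_min size_drop.
by have := ltn_ord I.2; have := ltn_ord I.1; lia.
Qed.

Lemma substr_neq_nil I : wf_interval I -> substr I != [::].
Proof. by rewrite -size_eq0 size_substr /wf_interval; lia. Qed.

Lemma occ_substr_gt0 I : 0 < occ S (substr I).
Proof.
by apply/card_gt0P; exists I.1; rewrite inE size_substr /substr.
Qed.

Lemma uniqueE I : wf_interval I -> unique I = ~~ repeating I.
Proof.
move=> wfI; rewrite /unique /repeating /unique_sub /repeating_sub.
by rewrite wfI substr_neq_nil //=; have := occ_substr_gt0 I; lia.
Qed.

Lemma unique_wf I : unique I -> wf_interval I.
Proof. by case/andP. Qed.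

(** Cutting the window of [I] out of both copies of [substr J] moves the occurrence at [k] by the
    offset [I.1 - J.1]. *)
Lemma occurrence_sub I J (k : nat) :
    wf_interval I -> sub_interval I J -> k < size S ->
    take (J.2.+1 - J.1) (drop k S) = substr J ->
  k + (I.1 - J.1) < size S /\
  take (I.2.+1 - I.1) (drop (k + (I.1 - J.1)) S) = substr I.
Proof.
rewrite /wf_interval => wfI /andP[le1 le2] ltk eqJ; split.
  (* [take] truncates silently at the end of [S]; comparing lengths shows that the copy at [k]
     fits. *)
  have := congr1 size eqJ; rewrite size_substr size_take_min size_drop.
  by have := ltn_ord J.2; lia.
pose cut s := take (I.2.+1 - I.1) (drop (I.1 - J.1) (s : seq T)).
have cut_take X : cut (take (J.2.+1 - J.1) X) = cut X.
  by rewrite /cut !take_drop take_takel //; lia.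
have := congr1 cut eqJ; rewrite /substr !cut_take /cut !drop_drop.
by rewrite subnK // [_ + k]addnC.
Qed.

(** Two distinct occurrences of [substr J], shifted by the same offset, stay distinct. *)
Lemma repeating_sub_interval I J :
  wf_interval I -> sub_interval I J -> repeating J -> repeating I.
Proof.
move=> wfI sIJ /and3P[_ _ /card_gt1P[x [y []]]].
rewrite !inE size_substr => /eqP ox /eqP oy neq.
have [ltx {}ox] := occurrence_sub wfI sIJ (ltn_ord x) ox.
have [lty {}oy] := occurrence_sub wfI sIJ (ltn_ord y) oy.
apply/and3P; split=> //; first exact: substr_neq_nil.
apply/card_gt1P; exists (Ordinal ltx), (Ordinal lty).
rewrite !inE size_substr /= ox oy; split=> //.
by apply: contra neq => /eqP[/addIn/val_inj->].
Qed.

Lemma unique_super I J :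
  wf_interval J -> sub_interval I J -> unique I -> unique J.
Proof.
move=> wfJ sIJ uI; have wfI := unique_wf uI; move: uI.
by rewrite !uniqueE //; apply/contra/repeating_sub_interval.
Qed.

Lemma SUS_min K I J :
  is_SUS K I -> unique J -> sub_interval K J -> I.2 - I.1 <= J.2 - J.1.
Proof.
case/and3P=> _ _ /forallP/(_ J) minI uJ sKJ; have wfJ := unique_wf uJ.
rewrite leqNgt; apply/negP=> ltJI; move: uJ.
by rewrite uniqueE // (implyP minI) // wfJ sKJ.
Qed.

Lemma nonMUS_unique_sub I : unique I -> I \notin MUS S ->
  exists J, [/\ unique J, sub_interval J I & shorter J I].
Proof.
rewrite inE /is_MUS => -> /= /forallPn[J].
rewrite negb_imply => /andP[/and3P[wfJ sJI ltJ] nrJ].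
by exists J; rewrite uniqueE.
Qed.

Definition left_extension I : bool :=
  is_SUS (I.1, I.1) I &&
  [exists J : interval S, [&& unique J, J.1 == I.1.+1 :> nat & J.2 == I.2]].

(** Not the mirror image of [left_extension]: strictness makes [I.2.-1] an exact predecessor lying
    in [I], which is what a clash with a left extension uses. *)
Definition right_extension I : bool := is_SUS (I.2, I.2) I && (I.1 < I.2).

Lemma left_extensionP I : left_extension I ->
  is_SUS (I.1, I.1) I /\
  exists J : interval S, [/\ unique J, J.1 = I.1.+1 :> nat & J.2 = I.2].
Proof.
by case/andP=> sI /existsP[J /and3P[uJ /eqP e1 /eqP e2]]; split=> //; exists J.
Qed.

Lemma nonMUS_SUS_extension I p :
  is_SUS (p, p) I -> I \notin MUS S -> left_extension I || right_extension I.
Proof.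
case: I => i1 i2 sI nMI; have /and3P[uI /andP[/= le1p lep2] _] := sI.
have [[j1 j2] [uJ /andP[/= le1 le2]]] := nonMUS_unique_sub uI nMI.
have wfJ : j1 <= j2 := unique_wf uJ; rewrite /shorter /= => ltJI.
have [ltpJ | leJp] := ltnP p j1.
  (* [J] lies to the right of [p]: stretched left to [p] it is a unique interval inside [I], so
     minimality forces [p = i1]. *)
  have uK : unique ((p, j2) : interval S).
    by apply: (unique_super _ _ uJ); rewrite /wf_interval /sub_interval /=; lia.
  have leIK : i2 - i1 <= j2 - p.
    by apply: (SUS_min sI uK); rewrite /sub_interval /=; lia.
  have eqp : p = i1 by apply: val_inj => /=; lia.
  have lt1 : i1.+1 < size S by have := ltn_ord j1; lia.
  rewrite /left_extension /= -{1 2}eqp sI /=; apply/orP; left.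
  apply/existsP; exists (Ordinal lt1, i2); rewrite /= !eqxx !andbT.
  apply: (unique_super _ _ uJ); rewrite /wf_interval /sub_interval /=; first lia.
  by rewrite -eqp; lia.
(* If [J] contained [p], it would be too short for the minimality of [I]. *)
have [ltJp | lepJ] := ltnP j2 p; last first.
  have /= := SUS_min sI uJ; rewrite /sub_interval /= leJp lepJ => /(_ isT).
  by lia.
have uK : unique ((j1, p) : interval S).
  by apply: (unique_super _ _ uJ); rewrite /wf_interval /sub_interval /=; lia.
have leIK : i2 - i1 <= p - j1.
  by apply: (SUS_min sI uK); rewrite /sub_interval /=; lia.
have eqp : p = i2 by apply: val_inj => /=; lia.
by apply/orP; right; rewrite /right_extension /= -{1 2}eqp sI /=; lia.
Qed.

Lemma nonMUS_PS_extension I :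
  I \in PS S :\: MUS S -> left_extension I || right_extension I.
Proof.
rewrite in_setD => /andP[nMI /bigcupP[p _]].
by rewrite inE => sI; apply: (nonMUS_SUS_extension sI nMI).
Qed.

(* The gap between the 0-based positions k and k + 1 is numbered k. *)
Definition gap I : nat := if left_extension I then I.1 : nat else I.2.-1.

Lemma SUS_eq_len K I J : is_SUS K I -> is_SUS K J -> I.2 - I.1 = J.2 - J.1.
Proof.
move=> sI sJ; have /and3P[uI kI _] := sI; have /and3P[uJ kJ _] := sJ.
by apply/eqP; rewrite eqn_leq !(SUS_min (K := K)).
Qed.

Lemma SUS_wf K I : is_SUS K I -> I.1 <= I.2.
Proof. by case/and3P=> /unique_wf. Qed.

Lemma gap_left_right I J :
  left_extension I -> right_extension J -> (I.1 : nat) = J.2.-1 -> False.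
Proof.
case: I J => [i1 i2] [j1 j2] /left_extensionP[sI [[k1 k2] /= [uK eK1 eK2]]].
case/andP=> /= sJ ltJ e; subst k2.
have wfK : k1 <= i2 := unique_wf uK; have /and3P[uJ _ _] := sJ.
have leIJ : i2 - i1 <= j2 - j1.
  by apply: (SUS_min sI uJ); rewrite /sub_interval /=; lia.
have leJK : j2 - j1 <= i2 - k1.
  by apply: (SUS_min sJ uK); rewrite /sub_interval /=; lia.
lia.
Qed.

Lemma gap_inj : {in PS S :\: MUS S &, injective gap}.
Proof.
move=> I J /nonMUS_PS_extension eI /nonMUS_PS_extension eJ; rewrite /gap.
(* As in [gap], an interval that is an extension of both kinds counts as left; failing that test
   leaves a right extension. *)
case: (boolP (left_extension I)) eI => lI /= eI;
  case: (boolP (left_extension J)) eJ => lJ /= eJ e.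
- have [sI _] := left_extensionP lI; have [sJ _] := left_extensionP lJ.
  case: I J sI sJ e {lI lJ eI eJ} => [i1 i2] [j1 j2] /= sI sJ e.
  have e1 : i1 = j1 by apply: val_inj.
  subst j1; have /= e2 := SUS_eq_len sI sJ.
  have /= wI := SUS_wf sI; have /= wJ := SUS_wf sJ.
  by congr pair; apply: val_inj => /=; lia.
- by case: (gap_left_right lI eJ e).
- by case: (gap_left_right lJ eI (esym e)).
- case: I J eI eJ e {lI lJ} => [i1 i2] [j1 j2].
  move=> /andP[/= sI ltI] /andP[/= sJ ltJ] e.
  have e2 : i2 = j2 by apply: val_inj => /=; lia.
  subst j2; have /= e1 := SUS_eq_len sI sJ.
  by congr pair; apply: val_inj => /=; lia.
Qed.

Lemma gap_lt I : I \in PS S :\: MUS S -> gap I < (size S).-1.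
Proof.
move/nonMUS_PS_extension; rewrite /gap.
case: ifP => [/left_extensionP[_ [K [_ eK _]]] _ | _ /andP[_ ltI]].
  by have := ltn_ord K.1; lia.
by have := ltn_ord I.2; lia.
Qed.

Lemma card_nonMUS_PS : #|PS S :\: MUS S| <= (size S).-1.
Proof.
(* Pigeonhole: the gap numbers form a duplicate-free list of naturals below [(size S).-1]. *)
rewrite cardE -(size_map gap) -(size_iota 0 (size S).-1).
apply: uniq_leq_size => [|k /mapP[I]].
  rewrite map_inj_in_uniq ?enum_uniq // => I J; rewrite !mem_enum.
  exact: gap_inj.
by rewrite mem_enum mem_iota => /gap_lt ltI ->.
Qed.

End PointSUS.

Theorem theorem2 (T : eqType) (S : seq T) :
  #|PS S| <= size S + #|MUS S| - 1.
Proof.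
(* A point SUS provides a position [p], so [S] is non-empty and the truncated [- 1] is exact. *)
have [-> | [I /bigcupP[p _ _]]] := set_0Vmem (PS S); first by rewrite cards0.
have := card_nonMUS_PS S; have := ltn_ord p.
have := subset_leq_card (subsetIr (PS S) (MUS S)).
by rewrite -(cardsID (MUS S) (PS S)); lia.
Qed.
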